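(* Let $(\mathfrak A,[\cdot,\dots,\cdot])$ be an arbitrary $n$-ary algebra with a fixed basis $\mathcal B=\{e_i:i\in I\}$, and let $\mathfrak A=\bigoplus_{[\mathfrak A_{[e_i]}]\in\mathcal F/\approx}\overbrace{\mathfrak A_{[e_i]}}$ be the decomposition into ideals constructed from $f=[\cdot,\dots,\cdot]$ and $\mathcal B$ in the context. For any ideal $\overbrace{\mathfrak A_{[e_i]}}$ of this decomposition, the algebra $(\overbrace{\mathfrak A_{[e_i]}},[\cdot,\dots,\cdot])$ (with restricted product) is simple if and only if $\mathrm{Ann}(\overbrace{\mathfrak A_{[e_i]}})=0$ and $\mathcal B':=\mathcal B\cap\overbrace{\mathfrak A_{[e_i]}}$ is an $i$-division basis of $\overbrace{\mathfrak A_{[e_i]}}$.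
   Context: An $n$-ary algebra ($n\ge2$) is a linear space $\mathfrak A$ of arbitrary dimension over an arbitrary field $\mathbb F$ with an $n$-linear map $[\cdot,\dots,\cdot]:\mathfrak A\times\cdots\times\mathfrak A\to\mathfrak A$ (the product), no identity being assumed. Write $f$ for the product. A superscript $(k)$ marks the $k$-th entry of $f$: $f(\mathfrak A,\dots,W^{(k)},\dots,\mathfrak A)$ is the span of all values of $f$ with $k$-th entry in $W$ and all other entries in $\mathfrak A$, and $f(\mathfrak A,\dots,V_1^{(k_1)},\dots,V_2^{(k_2)},\dots,\mathfrak A)$ is the span of all values with $k_1$-th entry in $V_1$, $k_2$-th entry in $V_2$ and the other entries in $\mathfrak A$. A linear subspace $\mathfrak I$ is an ideal if $[\mathfrak A,\dots,\mathfrak I^{(r)},\dots,\mathfrak A]\subset\mathfrak I$ for all $r\in\{1,\dots,n\}$. $\mathfrak A$ is simple if its product is nonzero and its only ideals are $\{0\}$ and $\mathfrak A$. $\mathrm{Ann}(\mathfrak A)=\{x\in\mathfrak A:[\mathfrak A,\dots,x^{(k)},\dots,\mathfrak A]=0\text{ for all }k\in\{1,\dots,n\}\}$. A basis $\mathcal B$ of an $n$-ary algebra $\mathbb A$ is an $i$-division basis if for any $e\in\mathcal B$ and $b_1,\dots,b_{n-1}\in\mathbb A$ such that $[b_1,\dots,e^{(k)},\dots,b_{n-1}]=w\neq0$ for some $k\in\{1,\dots,n\}$ ($e$ in the $k$-th entry, the $b$'s filling the others in order), one has $e,b_1,\dots,b_{n-1}\in\mathcal I(w)$, where $\mathcal I(w)$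 is the ideal of $\mathbb A$ generated by $w$. (In ''$i$-division'' the letter $i$ is part of the name.) For $\overbrace{\mathfrak A_{[e_i]}}$ these notions refer to it as an $n$-ary algebra in its own right. Construction from a basis $\mathcal B$. For each $e\in\mathcal B$ introduce a symbol $\overline e\notin\mathcal B$; $\overline{\mathcal B}=\{\overline e:e\in\mathcal B\}$, $\overline{(\overline e)}:=e$. Let $\mathfrak A^*=\mathfrak A\setminus\{0\}$ and $\mathcal P(\mathfrak A^* )$ its power set. Define $F:\mathcal P(\mathfrak A^* )\times(\mathcal B\dot\cup\overline{\mathcal B})^{n-1}\to\mathcal P(\mathfrak A^* )$ as follows: $F(\emptyset,\dots)=\emptyset$; for $U\ne\emptyset$ and $\xi_1,\dots,\xi_{n-1}\in\mathcal B$, $$F(U,\xi_1,\dots,\xi_{n-1})=\Big(\bigcup_{1\le k\le n,\ \sigma\in\mathbb S_{n-1}}\{f(\xi_{\sigma(1)},\dots,u^{(k)},\dots,\xi_{\sigma(n-1)}):u\in U\}\Big)\setminus\{0\},$$ $$F(U,\overline\xi_1,\dots,\overline\xi_{n-1})=\Big(\bigcup_{1\le k\le n,\ \sigma\in\mathbb S_{n-1}}\{u\in\mathfrak A:f(\xi_{\sigma(1)},\dots,u^{(k)},\dots,\xi_{\sigma(n-1)})\in U\}\Big)\setminus\{0\},$$ where $u$ is in the $k$-th entry and the remaining entries are filled in order by $\xi_{\sigma(1)},\dots,\xi_{\sigma(n-1)}$; and $F(U,\dots)=\emptyset$ if among the last $n-1$ arguments there is one in $\mathcal B$ and one in $\overline{\mathcal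 B}$. $e_i\in\mathcal B$ is connected to $e_j\in\mathcal B$ (written $e_i\sim e_j$) if $e_i=e_j$ or there is an ordered list $(X_1,\dots,X_m)$, $m\ge1$, of $(n-1)$-tuples $X_r\in(\mathcal B\dot\cup\overline{\mathcal B})^{n-1}$ such that $F(\{e_i\},X_1)\ne\emptyset$, $F(F(\{e_i\},X_1),X_2)\neq\emptyset$, ..., $F(\dots F(F(\{e_i\},X_1),X_2)\dots,X_{m-1})\ne\emptyset$ and $e_j\in F(F(\dots F(F(\{e_i\},X_1),X_2)\dots,X_{m-1}),X_m)$. This is an equivalence relation on $\mathcal B$; $[e_i]$ is the class of $e_i$, $\mathfrak A_{[e_i]}:=\bigoplus_{e_j\in[e_i]}\mathbb F e_j$, so $\mathfrak A=\bigoplus_{[e_i]\in\mathcal B/\sim}\mathfrak A_{[e_i]}$, and $\Pi_{\mathfrak A_{[e_i]}}:\mathfrak A\to\mathfrak A_{[e_i]}$ is the associated projection. Let $\mathcal F=\{\mathfrak A_{[e_i]}:[e_i]\in\mathcal B/\sim\}$. Put $\mathfrak A_{[e_i]}\approx\mathfrak A_{[e_j]}$ iff $\mathfrak A_{[e_i]}=\mathfrak A_{[e_j]}$ or there is $\{[\xi_1],\dots,[\xi_m]\}\subset\mathcal B/\sim$ with $[\xi_1]=[e_i]$, $[\xi_m]=[e_j]$ and, for each $r=1,\dots,m-1$, $$\sum_{1\le k_1<k_2\le n}\Big[\Pi_{\mathfrak A_{[\xi_r]}}\big(f(\mathfrak A,\dots,\mathfrak A_{[\xi_{r+1}]}^{(k_1)},\dots,\mathfrak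 A_{[\xi_{r+1}]}^{(k_2)},\dots,\mathfrak A)\big)+\Pi_{\mathfrak A_{[\xi_{r+1}]}}\big(f(\mathfrak A,\dots,\mathfrak A_{[\xi_r]}^{(k_1)},\dots,\mathfrak A_{[\xi_r]}^{(k_2)},\dots,\mathfrak A)\big)\Big]\ne0$$ (a sum of linear subspaces). This is an equivalence relation on $\mathcal F$; $[\mathfrak A_{[e_i]}]$ denotes the class of $\mathfrak A_{[e_i]}$, and $\overbrace{\mathfrak A_{[e_i]}}:=\bigoplus_{\mathfrak A_{[e_j]}\in[\mathfrak A_{[e_i]}]}\mathfrak A_{[e_j]}$; each of these is an ideal of $\mathfrak A$. *)

(* Defs.v *)
From mathcomp Require Import all_boot all_fingroup all_algebra.
From mathcomp Require Import boolp classical_sets.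

Set Implicit Arguments.
Unset Strict Implicit.
Unset Printing Implicit Defensive.

Import GRing.Theory.

Local Open Scope classical_set_scope.
Local Open Scope ring_scope.

Section LinearSpaces.
Variables (F : fieldType) (A : lmodType F).
Implicit Types (S V W B : set A).

Definition subspace W : Prop :=
  W 0 /\ forall (a : F) (x y : A), W x -> W y -> W (a *: x + y).

(* A has arbitrary dimension, so the spans of vector.v do not apply. *)
Definition lspan S : set A := smallest subspace S.

Definition lin_indep S : Prop :=
  forall (s : seq A) (c : A -> F), uniq s -> (forall x, x \in s -> S x) ->
    \sum_(x <- s) c x *: x = 0 -> forall x, x \in s -> c x = 0.

Definition is_basis V B : Prop := [/\ B `<=` V, lin_indep B & lspan B = V].

(* When B is a basis of A and C is a subset of B, A is the direct sum of
   lspan C and lspan (B \ C): the set below is then a singleton, and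
   proj B C is the projection of A onto lspan C along lspan (B \ C). *)
Definition proj B C (x : A) : A :=
  xget 0 [set y | lspan C y /\ lspan (B `\` C) (x - y)].

End LinearSpaces.

Section NaryAlgebras.
Variables (F : fieldType) (A : lmodType F) (n : nat).

(* The list of n entries with u in the k-th entry, the other entries being
   filled in order by b. *)
Definition fill (k : 'I_n) (u : A) (b : {ffun 'I_n.-1 -> A}) :
    {ffun 'I_n -> A} :=
  [ffun j => if unlift k j is Some j' then b j' else u].

Definition multilinear (f : {ffun 'I_n -> A} -> A) : Prop :=
  forall (k : 'I_n) (b : {ffun 'I_n.-1 -> A}) (a : F) (u v : A),
    f (fill k (a *: u + v) b) = a *: f (fill k u b) + f (fill k v b).

Variable f : {ffun 'I_n -> A} -> A.

(* f(W_1, ..., W_n) *)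
Definition fspan (W : 'I_n -> set A) : set A :=
  lspan [set f x | x in [set x : {ffun 'I_n -> A} | forall j, W j (x j)]].

(* The following notions concern the n-ary algebra (V, f), where V is a
   subspace of A closed under f: all ideals are ideals of V, and all entries of
   products are taken in V. The algebra (A, f) is the case V = setT. *)

Definition ideal (V I : set A) : Prop :=
  [/\ subspace I, I `<=` V &
      forall r : 'I_n, fspan (fun j => if j == r then I else V) `<=` I].

Definition simple (V : set A) : Prop :=
  (exists x : {ffun 'I_n -> A}, (forall j, V (x j)) /\ f x != 0) /\
  forall I, ideal V I -> I = [set 0] \/ I = V.

Definition Ann (V : set A) : set A :=
  [set x | V x /\ forall (k : 'I_n) (b : {ffun 'I_n.-1 -> A}),
                    (forall j, V (b j)) -> f (fill k x b) = 0].

Definition ideal_gen (V : set A) (w : A) : set A := smallest (ideal V) [set w].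

Definition i_division_basis (V B : set A) : Prop :=
  is_basis V B /\
  forall (e : A) (b : {ffun 'I_n.-1 -> A}) (k : 'I_n),
    B e -> (forall j, V (b j)) ->
    let w := f (fill k e b) in
    w != 0 -> ideal_gen V w e /\ forall j, ideal_gen V w (b j).

Variable B : set A.

(* In B + B, inl stands for the elements of B and inr for their barred
   copies. *)
Definition Btuple : Type := {ffun 'I_n.-1 -> set_type B + set_type B}.

Definition permuted (xi : {ffun 'I_n.-1 -> set_type B}) (s : 'S_n.-1) :
    {ffun 'I_n.-1 -> A} :=
  [ffun j => val (xi (s j))].

(* All values avoid 0, and are empty on U = set0 and on mixed tuples X; only
   sets U avoiding 0 are of interest. *)
Definition Fmap (U : set A) (X : Btuple) : set A :=
  [set v | v != 0 /\
    ((exists xi : {ffun 'I_n.-1 -> set_type B}, (forall j, X j = inl (xi j)) /\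
        exists (k : 'I_n) (s : 'S_n.-1) (u : A),
          U u /\ v = f (fill k u (permuted xi s)))
     \/
     (exists xi : {ffun 'I_n.-1 -> set_type B}, (forall j, X j = inr (xi j)) /\
        exists (k : 'I_n) (s : 'S_n.-1), U (f (fill k v (permuted xi s)))))].

Definition Fiter (U : set A) (Xs : seq Btuple) : set A := foldl Fmap U Xs.

Definition connected (e e' : A) : Prop :=
  e = e' \/
  exists Xs : seq Btuple,
    [/\ (0 < size Xs)%N,
        forall r, (0 < r < size Xs)%N -> Fiter [set e] (take r Xs) !=set0 &
        Fiter [set e] Xs e'].

Definition class (e : A) : set A := [set e' | B e' /\ connected e e'].

Definition Acl (e : A) : set A := lspan (class e).

Definition Pi (e : A) : A -> A := proj B (class e).

(* f(A, ..., W^(k1), ..., W^(k2), ..., A) *)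
Definition fspan2 (k1 k2 : 'I_n) (W : set A) : set A :=
  fspan (fun j => if (j == k1) || (j == k2) then W else setT).

Definition link (e e' : A) : Prop :=
  lspan (\bigcup_(k in [set k : 'I_n * 'I_n | (k.1 < k.2)%N])
           (Pi e @` fspan2 k.1 k.2 (Acl e') `|`
            Pi e' @` fspan2 k.1 k.2 (Acl e))) <> [set 0].

(* The relation between A_[e] and A_[e'] *)
Definition approx (e e' : A) : Prop :=
  Acl e = Acl e' \/
  exists (m : nat) (xi : nat -> A),
    [/\ forall r, (r <= m)%N -> B (xi r),
        class (xi 0) = class e, class (xi m) = class e' &
        forall r, (r < m)%N -> link (xi r) (xi r.+1)].

Definition overbrace (e : A) : set A :=
  lspan (\bigcup_(e' in [set e' | B e' /\ approx e e']) Acl e').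

End NaryAlgebras.

(* Main.v *)
Require Import Defs.
From mathcomp Require Import all_boot all_fingroup all_algebra.
From mathcomp Require Import boolp classical_sets.
From Stdlib Require Import Relation_Operators Operators_Properties.

Set Implicit Arguments.
Unset Strict Implicit.
Unset Printing Implicit Defensive.

Import GRing.Theory.

Local Open Scope classical_set_scope.
Local Open Scope ring_scope.

(** Write V for the overbrace of e. A nonzero product of basis vectors has all
    its entries in one class, because each entry is joined to the product by an
    arrow (product_class). If the product has a component in another class, the
    two classes are linked. Hence V is a subalgebra (subalgebra_overbrace), and
    the basis vectors that lie in V form a basis of it.

    If V is simple, its annihilator is a proper ideal, so it is zero, and every
    nonzero element generates V as an ideal, so the division property holds
    (simple_division).

    Conversely, assume that Ann V = 0 and that the division property holds, and
    let I be a nonzero ideal of V. A nonzero element of I has a nonzero product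
    with basis vectors of V. That product lies in I, so by division the basis
    vectors do too. It remains to propagate this to all basis vectors of V.

    - Inside a class (class_absorb) one follows a path of arrows. The difficulty
      is that the vectors on the path range over the whole algebra and may leave
      V. But every basis vector outside V annihilates the whole algebra
      (outside_brace_Ann): otherwise a vector a of V, modified by adding such a
      vector c, would be joined by arrows both to a product from V, hence to a,
      and to a product involving c, hence to c, and c would belong to V. So V
      and the global annihilator together span the algebra, and being in I
      modulo that annihilator is invariant under arrows in both directions
      (arrow_absorb): forwards because I is an ideal, backwards by division.

    - From a class to a linked one (link_absorb), the zero annihilator gives, for
      a vector w with a component in some class, vectors of that class whose
      product with w is nonzero (component_partner), and division lets I pass
      from some factors of such a product to all of them. *)

(** * Spans and linear independence in arbitrary dimension *)

Section Spans.
Variables (F : fieldType) (A : lmodType F).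
Implicit Types (S V W B C : set A).

Lemma subspaceD W x y : subspace W -> W x -> W y -> W (x + y).
Proof. by case=> _ h Wx Wy; rewrite -[x]scale1r; exact: h. Qed.

Lemma subspaceZ W a x : subspace W -> W x -> W (a *: x).
Proof. by case=> W0 h Wx; rewrite -[a *: x]addr0; exact: h. Qed.

Lemma subspaceB W x y : subspace W -> W x -> W y -> W (x - y).
Proof.
by move=> sW Wx Wy; rewrite -scaleN1r; apply: subspaceD => //; exact: subspaceZ.
Qed.

Lemma subspace_sum W (s : seq A) (P : pred A) (g : A -> A) :
  subspace W -> (forall y, y \in s -> P y -> W (g y)) ->
  W (\sum_(y <- s | P y) g y).
Proof.
move=> sW h; rewrite big_seq_cond.
apply: (big_ind W) => [|x y|y /andP[]]; first by case: sW.
  exact: subspaceD.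
exact: h.
Qed.

Lemma subspace0 : subspace ([set 0] : set A).
Proof. by split=> // a x y /= -> ->; rewrite scaler0 addr0. Qed.

Lemma subspace_lspan S : subspace (lspan S).
Proof.
split=> [W [[]]//|a x y Sx Sy W [sW SW]].
by case: (sW) => _; apply; [exact: Sx|exact: Sy].
Qed.

Lemma lspan_sub S x : S x -> lspan S x.
Proof. exact: sub_gen_smallest. Qed.

Lemma lspan0 S : lspan S 0.
Proof. by case: (subspace_lspan S). Qed.

Lemma lspanZ S a x : lspan S x -> lspan S (a *: x).
Proof. exact: (subspaceZ a (subspace_lspan S)). Qed.

Lemma lspanB S x y : lspan S x -> lspan S y -> lspan S (x - y).
Proof. exact: (subspaceB (subspace_lspan S)). Qed.

Lemma lspan_sum S (s : seq A) (P : pred A) (g : A -> A) :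
  (forall y, y \in s -> P y -> lspan S (g y)) ->
  lspan S (\sum_(y <- s | P y) g y).
Proof. exact: (subspace_sum (subspace_lspan S)). Qed.

Lemma lspan_min S W : subspace W -> S `<=` W -> lspan S `<=` W.
Proof. exact: smallest_sub. Qed.

Lemma lspanS S W : S `<=` W -> lspan S `<=` lspan W.
Proof.
by move=> SW; apply: lspan_min; [exact: subspace_lspan|move=> x /SW /lspan_sub].
Qed.

Lemma lspanP S x : lspan S x ->
  exists (s : seq A) (c : A -> F),
    [/\ uniq s, forall y, y \in s -> S y & x = \sum_(y <- s) c y *: y].
Proof.
pose T := [set x | exists (s : seq A) (c : A -> F),
    [/\ uniq s, forall y, y \in s -> S y & x = \sum_(y <- s) c y *: y]].
suff sT : subspace T.
  apply: (lspan_min sT) => y Sy; exists [:: y], (fun=> 1); split=> //.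
    by move=> z; rewrite inE => /eqP ->.
  by rewrite big_seq1 scale1r.
split=> [|a _ _ [s [c [us Ss ->]]] [t [d [ut St ->]]]].
  by exists [::], (fun=> 0); split=> //; rewrite big_nil.
have ext (r q : seq A) (g : A -> F) : uniq r -> uniq q -> {subset r <= q} ->
    \sum_(y <- r) g y *: y = \sum_(y <- q) (if y \in r then g y else 0) *: y.
  move=> ur uq rq.
  rewrite [RHS](eq_bigr (fun y => if y \in r then g y *: y else 0)); last first.
    by move=> y _; case: ifP; rewrite ?scale0r.
  rewrite -big_mkcond /= -[RHS]big_filter; apply: perm_big.
  apply: uniq_perm; [by []|exact: filter_uniq|] => y.
  rewrite mem_filter; case yr: (y \in r) => //=.
  by rewrite (rq _ yr).
pose q := undup (s ++ t).
exists q, (fun y => a * (if y \in s then c y else 0)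
                    + (if y \in t then d y else 0)).
split; first exact: undup_uniq.
  by move=> y; rewrite mem_undup mem_cat => /orP[/Ss|/St].
rewrite (ext s q) ?undup_uniq //; last first.
  by move=> y ys; rewrite mem_undup mem_cat ys.
rewrite (ext t q) ?undup_uniq //; last first.
  by move=> y yt; rewrite mem_undup mem_cat yt orbT.
rewrite scaler_sumr -big_split /=; apply: eq_bigr => y _.
by rewrite scalerDl scalerA.
Qed.

(** Only a decomposition into finitely many basis vectors is ever summed up, so
    independence of the two halves reduces to that of a finite list. *)
Lemma lspan_disjoint B C x : lin_indep B -> C `<=` B ->
  lspan C x -> lspan (B `\` C) x -> x = 0.
Proof.
move=> iB CB /lspanP[s [c [us sC xs]]] /lspanP[t [d [ut tC xt]]].
have ts y : y \in t -> y \notin s.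
  by move=> /tC[_ nCy]; apply/negP => /sC.
pose g y := if y \in s then c y else - d y.
have gs : \sum_(y <- s) g y *: y = x.
  by rewrite xs !big_seq; apply: eq_bigr => y ys; rewrite /g ys.
have gt : \sum_(y <- t) g y *: y = - x.
  rewrite xt -sumrN !big_seq; apply: eq_bigr => y yt.
  by rewrite /g (negbTE (ts _ yt)) scaleNr.
have g0 : \sum_(y <- s ++ t) g y *: y = 0 by rewrite big_cat /= gs gt subrr.
rewrite -gs big_seq big1 // => y ys.
rewrite (iB (s ++ t) g _ _ g0) ?scale0r // ?mem_cat ?ys //.
  rewrite cat_uniq us ut andbT; apply/hasPn => z; exact: ts.
by move=> z; rewrite mem_cat => /orP[/sC/CB|/tC[]].
Qed.

Lemma indep_neq0 B x : lin_indep B -> B x -> x != 0.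
Proof.
move=> iB Bx; apply/eqP => x0; have /eqP := @oner_neq0 F; apply.
apply: (iB [:: x] (fun=> 1)); rewrite ?inE //.
  by move=> y; rewrite inE => /eqP ->.
by rewrite big_seq1 x0 scaler0.
Qed.

Lemma indep_lspanI B C x : lin_indep B -> C `<=` B -> B x -> lspan C x -> C x.
Proof.
move=> iB CB Bx Cx; apply: contrapT => nCx.
have /eqP := indep_neq0 iB Bx; apply; apply: (lspan_disjoint iB CB Cx).
exact: lspan_sub.
Qed.

Lemma lspan_split B C x : C `<=` B -> lspan B x ->
  exists y z, [/\ x = y + z, lspan C y & lspan (B `\` C) z].
Proof.
move=> CB /lspanP[s [c [us sB ->]]].
exists (\sum_(y <- s | `[< C y >]) c y *: y),
  (\sum_(y <- s | ~~ `[< C y >]) c y *: y).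
split; first by rewrite (bigID (fun y => `[< C y >])).
- apply: lspan_sum => y _ /asboolP Cy.
  by apply: lspanZ; exact: lspan_sub.
- apply: lspan_sum => y ys /asboolPn nCy.
  by apply: lspanZ; apply: lspan_sub; split=> //; exact: sB.
Qed.

(** The hypothesis says that the coordinate of x along each basis vector
    outside C vanishes. *)
Lemma lspan_coord B C x : lin_indep B -> lspan B x ->
  (forall y, B y -> ~ C y -> lspan (B `\` [set y]) x) -> lspan C x.
Proof.
move=> iB /lspanP[s [c [us sB xE]]] h; rewrite xE.
apply: lspan_sum => y ys _.
have [Cy|nCy] := pselect (C y); first by apply: lspanZ; exact: lspan_sub.
have By := sB _ ys.
suff -> : c y *: y = 0 by exact: lspan0.
apply: (@lspan_disjoint B [set y]) => //; first by move=> z ->.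
  by apply: lspanZ; exact: lspan_sub.
have -> : c y *: y = x - \sum_(z <- s | z != y) c z *: z.
  by rewrite xE (bigD1_seq y) //= addrK.
apply: lspanB; first exact: h.
apply: lspan_sum => z zs zy; apply: lspanZ; apply: lspan_sub.
by split; [exact: sB|exact/eqP].
Qed.

(** Turning the vanishing of a projection into membership in a span lets the
    multilinear expansion into products of basis vectors apply to it, without
    the projection being computed or shown linear. *)
Lemma proj_eq0 B C x : lin_indep B -> lspan B = setT -> C `<=` B ->
  proj B C x = 0 <-> lspan (B `\` C) x.
Proof.
move=> iB sB CB; rewrite /proj.
have [y [z [-> Cy Cz]]] : exists y z,
    [/\ x = y + z, lspan C y & lspan (B `\` C) z].
  by apply: lspan_split => //; rewrite sB.
case: xgetP => [v _ [Cv vz]|/(_ y) []]; last first.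
  by split=> //; rewrite addrAC subrr add0r.
split=> [v0|yz]; first by rewrite v0 subr0 in vz.
apply: (lspan_disjoint iB CB Cv).
have -> : v = y + z - (y + z - v) by rewrite opprB addrC subrK.
exact: lspanB.
Qed.

End Spans.

(** * Multilinear products, ideals and annihilators *)

Section Products.
Variables (F : fieldType) (A : lmodType F) (n : nat).
Implicit Types (x t : {ffun 'I_n -> A}) (b : {ffun 'I_n.-1 -> A}) (k r : 'I_n).

Definition rest k x : {ffun 'I_n.-1 -> A} := [ffun j => x (lift k j)].

Lemma fill_id k u b : fill k u b k = u.
Proof. by rewrite ffunE unlift_none. Qed.

Lemma fill_lift k u b j : fill k u b (lift k j) = b j.
Proof. by rewrite ffunE liftK. Qed.

Lemma fill_rest k x : fill k (x k) (rest k x) = x.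
Proof.
apply/ffunP => j; case: (unliftP k j) => [i ->|->]; last exact: fill_id.
by rewrite fill_lift ffunE.
Qed.

Lemma fill_all (P : 'I_n -> A -> Prop) k u b :
  P k u -> (forall j, P (lift k j) (b j)) -> forall i, P i (fill k u b i).
Proof.
move=> Pu Pb i; case: (unliftP k i) => [j ->|->]; last by rewrite fill_id.
by rewrite fill_lift.
Qed.

Variable f : {ffun 'I_n -> A} -> A.
Hypothesis hf : multilinear f.

Lemma fillD k u v b : f (fill k (u + v) b) = f (fill k u b) + f (fill k v b).
Proof. by rewrite -[u]scale1r hf !scale1r. Qed.

Lemma fill0 k b : f (fill k 0 b) = 0.
Proof. by apply: (addrI (f (fill k 0 b))); rewrite -fillD !addr0. Qed.

Lemma subspace_fill W k b : subspace W -> subspace [set u | W (f (fill k u b))].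
Proof.
move=> [W0 hW]; split=> [|a u v Wu Wv] /=; first by rewrite fill0.
by rewrite hf; exact: hW.
Qed.

(** Entries are replaced one at a time: at stage m those before m range over
    the spans and the others still over the generators. *)
Lemma multilinear_lspan W (S : 'I_n -> set A) : subspace W ->
  (forall x, (forall j, S j (x j)) -> W (f x)) ->
  forall x, (forall j, lspan (S j) (x j)) -> W (f x).
Proof.
move=> sW h x Sx.
suff H m : forall y : {ffun 'I_n -> A},
    (forall j : 'I_n, if (j < m)%N then lspan (S j) (y j) else S j (y j)) ->
    W (f y).
  by apply: (H n) => j; rewrite ltn_ord.
elim: m => [|m IH] y Sy; first by apply: h => j; exact: Sy.
have [mn|nm] := ltnP m n; last first.
  apply: IH => j; have jm := leq_trans (ltn_ord j) nm.
  by move: (Sy j); rewrite ltnS jm ltnW.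
pose k := Ordinal mn.
suff : lspan (S k) `<=` [set u | W (f (fill k u (rest k y)))].
  move=> /(_ (y k)) /=; rewrite fill_rest; apply.
  by move: (Sy k); rewrite ltnSn.
apply: lspan_min => [|u Su /=]; first exact: subspace_fill.
apply: IH.
apply: (@fill_all (fun j v => if (j < m)%N then lspan (S j) v else S j v)).
  by rewrite ltnn.
move=> j; rewrite ffunE; move: (Sy (lift k j)); rewrite ltnS leq_eqVlt.
have /negbTE -> // : (lift k j : nat) != m.
by apply: contraNneq (neq_lift k j) => jm; apply/eqP/val_inj.
Qed.

(** Used with W either the zero subspace or the kernel of a projection, this
    brings all questions about products down to products of basis vectors. *)
Lemma multilinear_escape W (S : 'I_n -> set A) x : subspace W ->
  (forall j, lspan (S j) (x j)) -> ~ W (f x) ->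
  exists t, (forall j, S j (t j)) /\ ~ W (f t).
Proof.
move=> sW Sx nW; apply: contrapT => H; apply: nW.
apply: (multilinear_lspan sW _ Sx) => t St; apply: contrapT => nWt.
by apply: H; exists t.
Qed.

Lemma multilinear_neq0 (S : 'I_n -> set A) x :
  (forall j, lspan (S j) (x j)) -> f x != 0 ->
  exists t, (forall j, S j (t j)) /\ f t != 0.
Proof.
move=> Sx /eqP fx; have [t [St /eqP ft]] := multilinear_escape (subspace0 A) Sx fx.
by exists t.
Qed.

Lemma rest_neq0 S k u b : (forall j, lspan S (b j)) -> f (fill k u b) != 0 ->
  exists c : {ffun 'I_n.-1 -> A}, (forall j, S (c j)) /\ f (fill k u c) != 0.
Proof.
move=> Sb fb.
pose T j := if j == k then [set u] else S.
have [] := @multilinear_neq0 T (fill k u b) _ fb.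
  apply: (@fill_all (fun j v => lspan (T j) v)).
    by rewrite /T eqxx; exact: lspan_sub.
  by move=> j; rewrite /T eq_sym (negbTE (neq_lift _ _)).
move=> t [Tt ft]; exists (rest k t); split=> [j|].
  by move: (Tt (lift k j)); rewrite /T eq_sym (negbTE (neq_lift _ _)) ffunE.
by have := Tt k; rewrite /T eqxx /= => <-; rewrite fill_rest.
Qed.

Lemma entry_neq0 S k u b : lspan S u -> f (fill k u b) != 0 ->
  exists v, S v /\ f (fill k v b) != 0.
Proof.
move=> Su /eqP fu; apply: contrapT => H; apply: fu.
suff : lspan S `<=` [set v | [set 0] (f (fill k v b))] by apply.
apply: lspan_min => [|v Sv]; first exact: (subspace_fill k b (subspace0 A)).
by apply: contrapT => /eqP fv; apply: H; exists v.
Qed.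

Definition subalgebra (V : set A) : Prop :=
  subspace V /\ forall x, (forall j, V (x j)) -> V (f x).

Lemma ideal_entry V I x r : ideal f V I ->
  (forall j, V (x j)) -> I (x r) -> I (f x).
Proof.
move=> [_ _ hI] Vx Ir; apply: (hI r); apply: lspan_sub; exists x => // j /=.
by case: eqP => [->|].
Qed.

Lemma entry_ideal V I : subspace I -> I `<=` V ->
  (forall x r, (forall j, V (x j)) -> I (x r) -> I (f x)) -> ideal f V I.
Proof.
move=> sI IV h; split=> // r; apply: lspan_min => // _ [x /= Wx <-].
apply: (h x r) => [j|]; last by move: (Wx r); rewrite eqxx.
by move: (Wx j); case: ifP => // _ /IV.
Qed.

Lemma ideal_self V : subalgebra V -> ideal f V V.
Proof. by move=> [sV hV]; apply: entry_ideal => // x _ Vx _; exact: hV. Qed.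

Lemma ideal_ideal_gen V w : subalgebra V -> V w -> ideal f V (ideal_gen f V w).
Proof.
move=> aV Vw; apply: entry_ideal.
- split=> [I [[[]]]//|a x y Ix Iy I [iI Iw]].
  by case: (iI) => -[_ sI] _ _; apply: sI; [exact: Ix|exact: Iy].
- by move=> x; apply; split; [exact: ideal_self|move=> _ ->].
- move=> x r Vx Ix I [iI Iw]; apply: (ideal_entry iI Vx (r := r)); exact: Ix.
Qed.

Lemma subspace_Ann V : subspace V -> subspace (Ann f V).
Proof.
move=> [V0 sV]; split=> [|a x y [Vx hx] [Vy hy]].
  by split=> // k b _; rewrite fill0.
split=> [|k b Vb]; first exact: sV.
by rewrite hf hx // hy // scaler0 addr0.
Qed.

Lemma Ann_entry V x r : (forall j, V (x j)) -> Ann f V (x r) -> f x = 0.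
Proof.
by move=> Vx [_ h]; rewrite -(fill_rest r x); apply: h => j; rewrite ffunE.
Qed.

Lemma ideal_Ann V : subspace V -> ideal f V (Ann f V).
Proof.
move=> sV; apply: entry_ideal => [|x []//|x r Vx Ax]; first exact: subspace_Ann.
by rewrite (Ann_entry Vx Ax); case: (subspace_Ann sV).
Qed.

(** In a simple algebra both conditions are immediate: the annihilator is a
    proper ideal, and a nonzero element generates the whole algebra. *)
Lemma simple_division V C : (0 < n)%N -> subalgebra V -> is_basis V C ->
  simple f V -> Ann f V = [set 0] /\ i_division_basis f V C.
Proof.
move=> n0 aV bC [[x [Vx fx]] sV]; split.
  have [//|AV] := sV _ (ideal_Ann aV.1).
  by move/eqP: fx; case; apply: (Ann_entry (r := Ordinal n0) Vx); rewrite AV.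
split=> // e b k Ce Vb /= w0; set w := f _ in w0 *.
have Ve : V e by case: bC => CV _ _; exact: CV.
have Vw : V w by apply: aV.2; exact: (@fill_all (fun _ => V)).
have [I0|->//] := sV _ (ideal_ideal_gen aV Vw).
suff : ideal_gen f V w w by rewrite I0 => /eqP; rewrite (negbTE w0).
exact: sub_gen_smallest.
Qed.

(** The division property holds for a product having a basis vector in any of
    its entries, and it passes to every ideal containing that product. *)
Lemma division_absorb V C I t r : i_division_basis f V C -> ideal f V I ->
  (forall j, V (t j)) -> C (t r) -> f t != 0 -> I (f t) -> forall j, I (t j).
Proof.
move=> [_ dC] iI Vt Ct ft It.
have gI : ideal_gen f V (f t) `<=` I by apply: smallest_sub => // _ ->.
have := dC (t r) (rest r t) r Ct; rewrite fill_rest => /(_ _ ft)[j|gr gb j].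
  by rewrite ffunE.
case: (unliftP r j) => [i ->|->]; last exact: gI.
by apply: gI; have := gb i; rewrite ffunE.
Qed.

End Products.

(** * Connected basis vectors *)

Section Connection.
Variables (F : fieldType) (A : lmodType F) (n : nat).
Variable f : {ffun 'I_n -> A} -> A.
Hypothesis hf : multilinear f.
Variable B : set A.
Hypothesis hB : is_basis setT B.

Local Notation class := (Defs.class f B).
Local Notation Acl := (Acl f B).

Let iB : lin_indep B. Proof. by case: hB. Qed.
Let sB : lspan B = setT. Proof. by case: hB. Qed.

(** The steps of a connection, taken between single vectors and in the
    unbarred direction only. *)
Definition arrow (u v : A) : Prop :=
  [/\ u != 0, v != 0 & exists (k : 'I_n) (xi : {ffun 'I_n.-1 -> A}),
    (forall j, B (xi j)) /\ v = f (fill k u xi)].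

Lemma Fmap_arrow (U : set A) (X : Btuple n B) v : (forall u, U u -> u != 0) ->
  Fmap f U X v -> exists2 u, U u & arrow u v \/ arrow v u.
Proof.
move=> U0 [v0 [[xi [_ [k [s [u [Uu vE]]]]]]|[xi [_ [k [s Uf]]]]]].
  exists u => //; left; split; [exact: U0|by []|exists k, (permuted xi s)].
  by split=> // j; rewrite ffunE; apply: set_mem; exact: (valP (xi (s j))).
exists (f (fill k v (permuted xi s))) => //.
right; split; [by []|exact: U0|exists k, (permuted xi s)].
by split=> // j; rewrite ffunE; apply: set_mem; exact: (valP (xi (s j))).
Qed.

Lemma arrow_Fmap u v : arrow u v \/ arrow v u ->
  exists X : Btuple n B, Fmap f [set u] X v.
Proof.
have lift_B (xi : {ffun 'I_n.-1 -> A}) : (forall j, B (xi j)) ->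
    exists zeta : {ffun 'I_n.-1 -> set_type B}, permuted zeta 1%g = xi.
  move=> Bxi; exists [ffun j => SigSub (mem_set (Bxi j))].
  by apply/ffunP => j; rewrite !ffunE perm1.
case=> -[u0 v0 [k [xi [/lift_B[zeta zE] vE]]]].
- exists [ffun j => inl (zeta j)]; split=> //; left; exists zeta; split=> [j|].
    by rewrite ffunE.
  by exists k, 1%g, u; rewrite zE.
- exists [ffun j => inr (zeta j)]; split=> //; right; exists zeta; split=> [j|].
    by rewrite ffunE.
  by exists k, 1%g; rewrite zE -vE.
Qed.

Lemma Fiter_nonempty (U : set A) (Xs : seq (Btuple n B)) :
  Fiter f U Xs !=set0 -> U !=set0.
Proof.
elim: Xs U => [//|X Xs IH] U /IH[v [_ [[xi [_ [k [s [u [Uu _]]]]]]|]]].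
  by exists u.
by case=> xi [_ [k [s Uf]]]; exists (f (fill k v (permuted xi s))).
Qed.

Lemma Fiter_mono (U U' : set A) (Xs : seq (Btuple n B)) :
  U `<=` U' -> Fiter f U Xs `<=` Fiter f U' Xs.
Proof.
elim: Xs U U' => [//|X Xs IH] U U' UU'; apply: IH => v [v0 h]; split=> //.
case: h => -[xi [Xxi [k [s h]]]]; [left|right]; exists xi; split=> //; exists k, s.
  by case: h => u [/UU' Uu vE]; exists u.
exact: UU'.
Qed.

(** Barred tuples undo unbarred ones, and enlarging the starting set only
    enlarges what is reached; so connection amounts to following arrows
    forwards and backwards between single vectors. *)
Lemma connectedP e e' : B e ->
  connected f B e e' <-> clos_refl_sym_trans A arrow e e'.
Proof.
move=> Be; split=> [[->|[Xs [_ _]]]|]; first exact: rst_refl.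
  suff H (U : set A) : (forall u, U u -> u != 0) -> Fiter f U Xs e' ->
      exists2 u, U u & clos_refl_sym_trans A arrow u e'.
    by case/H => [u ->|u ->//]; exact: (indep_neq0 iB).
  elim: Xs U => [|X Xs IH] U U0; first by exists e' => //; exact: rst_refl.
  case/IH => [u []//|v Uv ve'].
  have [u Uu uv] := Fmap_arrow U0 Uv; exists u => //.
  apply: rst_trans ve'.
  by case: uv => uv; [apply: rst_step|apply: rst_sym; apply: rst_step].
move=> /(@clos_rst_rst1n _ _ _ _) ee'.
have [Xs eXs] : exists Xs : seq (Btuple n B), Fiter f [set e] Xs e'.
  elim: ee' => [x|x y z xy _ [Xs yXs]]; first by exists [::].
  have [X xX] := arrow_Fmap xy; exists (X :: Xs).
  by apply: Fiter_mono yXs => _ ->.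
case: Xs eXs => [->|X Xs eXs]; first by left.
right; exists (X :: Xs); split=> // r _.
apply: (@Fiter_nonempty _ (drop r (X :: Xs))).
by rewrite /Fiter -foldl_cat cat_take_drop; exists e'.
Qed.

Lemma classP e e' : B e ->
  class e e' <-> B e' /\ clos_refl_sym_trans A arrow e e'.
Proof. by move=> Be; split=> -[Be' /(connectedP _ Be)]. Qed.

Lemma class_sub e : class e `<=` B.
Proof. by move=> x []. Qed.

Lemma class_self e : B e -> class e e.
Proof. by split=> //; left. Qed.

Lemma class_eq e e' : B e -> class e e' -> class e = class e'.
Proof.
move=> Be /(classP _ Be)[Be' ee']; apply/seteqP; split=> x.
  move=> /(classP _ Be)[Bx ex]; apply/classP => //; split=> //.
  by apply: rst_trans ex; exact: rst_sym.
move=> /(classP _ Be')[Bx ex]; apply/classP => //; split=> //.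
exact: rst_trans ex.
Qed.

Lemma Acl_inj e e' : Acl e = Acl e' -> class e = class e'.
Proof.
have H a a' : Acl a = Acl a' -> class a `<=` class a'.
  move=> aa' x ax; apply: (indep_lspanI iB (@class_sub a')).
    exact: class_sub ax.
  by rewrite -/(Acl a') -aa'; exact: lspan_sub.
by move=> ee'; apply/seteqP; split; exact: H.
Qed.

(** All the entries are connected through the product itself, to which each of
    them has an arrow. *)
Lemma product_class (t : {ffun 'I_n -> A}) i j : (forall l, B (t l)) ->
  f t != 0 -> class (t i) (t j).
Proof.
move=> Bt ft; apply/classP => //; split=> //.
have H l : arrow (t l) (f t).
  split=> //; first exact: (indep_neq0 iB).
  by exists l, (rest l t); split=> [r|]; rewrite ?fill_rest ?ffunE.
apply: rst_trans (f t) _ _ _; first exact: rst_step.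
by apply: rst_sym; exact: rst_step.
Qed.

Lemma fill_class k c (b : {ffun 'I_n.-1 -> A}) j : B c -> (forall l, B (b l)) ->
  f (fill k c b) != 0 -> class c (b j).
Proof.
move=> Bc Bb fc; rewrite -[X in class X](fill_id k c b) -(fill_lift k c b j).
by apply: product_class => //; exact: (@fill_all _ _ _ (fun _ => B)).
Qed.

(** * Linked classes and their ideals *)

(** The contribution to a link between c and d of products of vectors of
    the class of c, phrased with basis vectors only and all n entries in the
    class, instead of two entries in its span and the others arbitrary. *)
Definition produces (c d : A) : Prop :=
  exists t : {ffun 'I_n -> A}, (forall j, class c (t j)) /\
    ~ lspan (B `\` class d) (f t).

Lemma link_sym c d : link f B c d -> link f B d c.
Proof.
by rewrite /link (eq_bigcupr (fun k _ => setUC _ _)).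
Qed.

(** A nonzero product of basis vectors with one entry in a class has all its
    entries there, so letting the remaining entries of a link range over the
    whole algebra adds nothing. *)
Lemma link_produces c d : B c -> B d ->
  link f B c d -> produces c d \/ produces d c.
Proof.
have H a a' : B a' -> forall (k : 'I_n * 'I_n) x,
    x \in Pi f B a @` fspan2 f k.1 k.2 (Acl a') -> x != 0 -> produces a' a.
  move=> Ba' k _ /set_mem[y fy <-] /eqP.
  rewrite /Pi => /(contra_not (proj2 (proj_eq0 _ iB sB (@class_sub a)))) ny.
  have {ny fy} [t [Bt nt]] : exists t : {ffun 'I_n -> A},
      (forall j, (if j == k.1 then class a' else B) (t j)) /\
      ~ lspan (B `\` class a) (f t).
    apply: contrapT => H; apply: ny.
    move: fy; apply: lspan_min => [|_ [x Wx <-]]; first exact: subspace_lspan.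
    apply: contrapT => nx; apply: H.
    pose S (j : 'I_n) := if j == k.1 then class a' else B.
    apply: (multilinear_escape hf (S := S) (subspace_lspan _) _ nx) => j.
    by move: (Wx j); rewrite /S; case: (j == k.1) => //= _; rewrite sB.
  exists t; split=> // j.
  have tk : class a' (t k.1) by have := Bt k.1; rewrite eqxx.
  rewrite (class_eq Ba' tk); apply: product_class => [l|].
    by have := Bt l; case: ifP => // _ /class_sub.
  by apply: contra_notN nt => /eqP ->; exact: lspan0.
move=> Bc Bd; rewrite /link; apply: contra_notP => nP.
apply/seteqP; split=> [|_ ->]; last exact: lspan0.
apply: lspan_min; first exact: subspace0.
move=> x [k _ kx] /=; apply: contrapT => /eqP x0; apply: nP.
by case: kx => [/mem_set /H xH|/mem_set /H xH]; [right|left]; apply: xH.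
Qed.

Lemma produces_link c d : (1 < n)%N -> produces c d -> link f B c d.
Proof.
move=> n1 [t [ct nt]] L0; apply: nt.
apply/(proj_eq0 (f t) iB sB (@class_sub d)).
suff : [set 0] (Pi f B d (f t)) by [].
rewrite -L0; apply: lspan_sub.
exists (Ordinal (ltnW n1), Ordinal n1) => //; right; exists (f t) => //.
apply: lspan_sub; exists t => // j /=.
by case: ifP => // _; apply: lspan_sub; exact: ct.
Qed.

Lemma approx_link e c d : B c -> B d -> approx f B e c -> link f B c d ->
  approx f B e d.
Proof.
move=> Bc Bd ec cd; right; case: ec => [/Acl_inj ec|[m [xi [Bxi x0 xm xl]]]].
  exists 1%N, (fun r => if r is 0 then c else d); split=> //.
    by case.
  by case.
exists m.+1, (fun r => if (r <= m)%N then xi r else d); split=> [r _|||r].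
- by case: ifP => // /Bxi.
- by [].
- by rewrite ltnn.
rewrite ltnS => rm; rewrite rm; case: ltngtP rm => // [rm _|-> _]; first exact: xl.
by rewrite /link /Pi /Defs.Acl xm.
Qed.

Lemma approx_class e c d : B c -> approx f B e c -> class c d -> approx f B e d.
Proof.
move=> Bc ec /(class_eq Bc) cd.
case: ec => [ec|[m [xi [Bxi x0 xm xl]]]]; first by left; rewrite ec /Defs.Acl cd.
by right; exists m, xi; split=> //; rewrite xm.
Qed.

Section Overbrace.
Variables (e : A) (n1 : (1 < n)%N).
Hypothesis Be : B e.

Local Notation V := (overbrace f B e).

Definition brace : set A := [set c | B c /\ approx f B e c].

Lemma brace_self : brace e.
Proof. by split=> //; left. Qed.

Lemma brace_sub : brace `<=` B.
Proof. by move=> x []. Qed.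

Lemma class_brace c : brace c -> class c `<=` brace.
Proof.
by move=> [Bc ec] d cd; split; [exact: class_sub cd|exact: approx_class cd].
Qed.

Lemma overbraceE : V = lspan brace.
Proof.
apply/seteqP; split; apply: lspan_min; try exact: subspace_lspan.
  move=> x [c [Bc ec]]; apply: lspanS => d cd.
  by apply: class_brace cd.
move=> c [Bc ec]; apply: lspan_sub; exists c => //.
by apply: lspan_sub; exact: class_self.
Qed.

Lemma overbraceI : B `&` V = brace.
Proof.
apply/seteqP; split=> [x [Bx]|x Dx].
  by rewrite overbraceE => Vx; apply: (indep_lspanI iB brace_sub Bx).
by split; [exact: brace_sub|rewrite overbraceE; exact: lspan_sub].
Qed.

Lemma overbrace_basis : is_basis V (B `&` V).
Proof.
split=> [x []//|s c us sV|]; last by rewrite overbraceI overbraceE.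
by apply: iB => // x /sV[].
Qed.

(** A nonzero product of basis vectors has all its entries in one class, say
    that of c; if the product has a nonzero component in another class, then
    this class is linked to that of c. *)
Lemma subalgebra_overbrace : subalgebra f V.
Proof.
have sV : subspace V by exact: subspace_lspan.
split=> // x Vx.
refine (multilinear_lspan hf (S := fun=> brace) sV _ _) => [t Dt|j]; last first.
  by rewrite -overbraceE.
have k0 : 'I_n := Ordinal (ltnW n1).
have Bt j : B (t j) by exact: brace_sub.
rewrite overbraceE; have [->|ft] := eqVneq (f t) 0; first exact: lspan0.
apply: (lspan_coord iB) => [|y By nDy]; first by rewrite sB.
apply: contrapT => ny; apply: nDy; split=> //.
have [Bc ec] := Dt k0; apply: (approx_link Bc By ec).
apply: produces_link => //; exists t; split=> [j|]; first exact: product_class.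
apply: contra_not ny; apply: lspanS => z [Bz nz]; split=> // zy.
by apply: nz; rewrite zy; exact: class_self.
Qed.

(** * Division forces simplicity *)

Section Division.
Hypothesis annV : Ann f V = [set 0].
Hypothesis divV : i_division_basis f V (B `&` V).

Let brace_V c : brace c -> V c.
Proof. by move=> Dc; rewrite overbraceE; exact: lspan_sub. Qed.

Let Ze := Ann f setT.

Let sZ : subspace Ze. Proof. exact: subspace_Ann. Qed.

(* Some index of a companion entry; it exists because products have at least
   two entries. *)
Let j0 : 'I_n.-1.
Proof. by apply: (@Ordinal _ 0); rewrite -ltnS prednK // ltnW. Qed.

Lemma nonzero_partner x : V x -> x != 0 ->
  exists (k : 'I_n) (b : {ffun 'I_n.-1 -> A}),
    (forall j, brace (b j)) /\ f (fill k x b) != 0.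
Proof.
move=> Vx /eqP x0; apply: contrapT => H; apply: x0.
suff : Ann f V x by rewrite annV.
split=> // k b Vb; apply: contrapT => /eqP fx; apply: H; exists k.
apply: (rest_neq0 hf _ fx) => j.
by rewrite -overbraceE.
Qed.

(** Suppose that c, outside the brace, has a nonzero product w with basis
    vectors. Choose a nonzero product u of basis vectors of the brace, and add c
    to the entry a of u that stands at the position of c in w. Since the two
    products involve different classes, replacing the entry by a + c changes
    neither u nor w, and a is connected to c via u, a + c and w. *)
Lemma outside_brace_Ann c : B c -> ~ brace c -> Ze c.
Proof.
move=> Bc nDc; split=> // k b _; apply: contrapT => /eqP fc.
have {b fc} [b [Bb fc]] : exists b : {ffun 'I_n.-1 -> A},
    (forall j, B (b j)) /\ f (fill k c b) != 0.
  by apply: (rest_neq0 hf _ fc) => j; rewrite sB.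
have [l [d [Dd fe]]] := nonzero_partner (brace_V brace_self) (indep_neq0 iB Be).
pose t := fill l e d; pose a := t k; pose g := rest k t.
have Dt j : brace (t j).
  by apply: (@fill_all _ _ _ (fun _ => brace)) => //; exact: brace_self.
have fa : f (fill k a g) != 0 by rewrite fill_rest.
have Dg j : brace (g j) by rewrite ffunE.
have ab : f (fill k a b) = 0.
  apply: contrapT => /eqP fab; apply: nDc.
  apply: (class_brace (Dt k)); rewrite -/a.
  have ab := fill_class j0 (brace_sub (Dt k)) Bb fab.
  have cb := fill_class j0 Bc Bb fc.
  rewrite (class_eq (brace_sub (Dt k)) ab) -(class_eq Bc cb).
  exact: class_self.
have cg : f (fill k c g) = 0.
  apply: contrapT => /eqP fcg; apply: nDc; apply: (class_brace (Dg j0)).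
  rewrite -(class_eq Bc); first exact: class_self.
  by apply: fill_class fcg => // j; exact: brace_sub.
have acg : f (fill k (a + c) g) = f (fill k a g) by rewrite fillD // cg addr0.
have acb : f (fill k (a + c) b) = f (fill k c b) by rewrite fillD // ab add0r.
have ac0 : a + c != 0.
  by apply: contra_neq fa => ac0; rewrite -acg ac0 fill0.
apply: nDc; apply: (class_brace (Dt k)); apply/classP; first exact: brace_sub.
split=> //; rewrite -/a.
have arr (u : A) (h : {ffun 'I_n.-1 -> A}) :
    u != 0 -> (forall j, B (h j)) -> f (fill k u h) != 0 ->
    clos_refl_sym_trans A arrow u (f (fill k u h)).
  by move=> u0 Bh fu; apply: rst_step; split=> //; exists k, h.
have Bg j : B (g j) by exact: brace_sub.
apply: rst_trans (f (fill k a g)) _ _ _.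
  by apply: arr => //; exact: (indep_neq0 iB (brace_sub (Dt k))).
apply: rst_trans (a + c) _ _ _.
  by apply: rst_sym; rewrite -acg; apply: arr => //; rewrite acg.
apply: rst_trans (f (fill k c b)) _ _ _.
  by rewrite -acb; apply: arr => //; rewrite acb.
by apply: rst_sym; apply: arr => //; exact: (indep_neq0 iB).
Qed.

(** So the algebra is the sum of V and a piece on which every product
    vanishes. *)
Lemma overbrace_Ann_split a : exists2 v, V v & Ze (a - v).
Proof.
have [|v [z [-> Dv Bz]]] := @lspan_split _ _ B brace a brace_sub.
  by rewrite sB.
exists v; first by rewrite overbraceE.
rewrite addrC addKr.
by move: Bz; apply: lspan_min => // c [Bc nDc]; exact: outside_brace_Ann.
Qed.

Lemma overbrace_Ann v : V v -> Ze v -> v = 0.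
Proof.
move=> Vv [_ Zv]; suff : Ann f V v by rewrite annV.
by split=> // k b _; exact: Zv.
Qed.

(** The partner can be taken in the class of d: vectors of this class multiply
    the component of w in that class and kill the other components. *)
Lemma component_partner d w : brace d -> ~ lspan (B `\` class d) w ->
  exists (k : 'I_n) (b : {ffun 'I_n.-1 -> A}),
    (forall j, class d (b j)) /\ f (fill k w b) != 0.
Proof.
move=> Dd nw; have Bd := brace_sub Dd.
have [|y [z [wE dy Bz]]] := @lspan_split _ _ B (class d) w (@class_sub d).
  by rewrite sB.
have y0 : y != 0 by apply: contra_notN nw => /eqP y0; rewrite wE y0 add0r.
have Vy : V y by rewrite overbraceE; apply: lspanS dy; exact: class_brace.
have [k [b [Db fy]]] := nonzero_partner Vy y0.
have Bb j : B (b j) by exact: brace_sub.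
have db j : class d (b j).
  have [c [dc fc]] := entry_neq0 hf dy fy.
  rewrite (class_eq Bd dc); apply: fill_class fc => //; exact: class_sub dc.
exists k, b; split=> //; rewrite wE fillD //.
suff -> : f (fill k z b) = 0 by rewrite addr0.
apply: contrapT => /eqP fz; have [c [[Bc ndc] fc]] := entry_neq0 hf Bz fz.
apply: ndc; rewrite (class_eq Bd (db j0)) -(class_eq Bc); first exact: class_self.
exact: fill_class fc.
Qed.

Variable I : set A.
Hypothesis iI : ideal f V I.

Let IV x : I x -> V x. Proof. by case: iI => _ + _; apply. Qed.

Let sI : subspace I. Proof. by case: iI. Qed.

Let brace_absorb (t : {ffun 'I_n -> A}) r : (forall j, V (t j)) ->
  brace (t r) -> f t != 0 -> I (f t) -> forall j, I (t j).
Proof.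
by move=> Vt Dt; apply: (division_absorb (r := r) divV iI Vt); rewrite overbraceI.
Qed.

(** A preimage of an element of I need not lie in V, but it does up to elements
    of the annihilator of the whole algebra, and arrows do not see these. *)
Lemma arrow_absorb u v : arrow u v ->
  (exists2 x, I x & Ze (u - x)) <-> (exists2 x, I x & Ze (v - x)).
Proof.
move=> [u0 v0 [k [xi [Bxi vE]]]].
have Zf a b : Ze (a - b) -> f (fill k a xi) = f (fill k b xi).
  move=> [_ Zab]; rewrite -[a](subrK b) fillD //.
  by rewrite Zab // add0r.
have Dxi j : brace (xi j).
  apply: contrapT => /(outside_brace_Ann (Bxi j)) Zx; move/eqP: v0; apply.
  by rewrite vE; apply: (@Ann_entry _ _ _ _ setT _ (lift k j)); rewrite ?fill_lift.
have Vfill a : V a -> forall j, V (fill k a xi j).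
  by move=> Va; apply: (@fill_all _ _ _ (fun _ => V)) => // j; exact: brace_V.
split=> [[x Ix ux]|[x Ix vx]].
  exists v; last by rewrite subrr; case: sZ.
  rewrite vE (Zf _ _ ux); apply: (ideal_entry (r := k) iI).
    by apply: Vfill; exact: IV.
  by rewrite fill_id.
have [u' Vu' uu'] := overbrace_Ann_split u; exists u' => //.
have vE' : v = f (fill k u' xi) by rewrite vE; exact: Zf.
have Vv : V v by rewrite vE'; apply: subalgebra_overbrace.2; exact: Vfill.
have Iv : I v.
  have /subr0_eq -> // : v - x = 0.
  by apply: overbrace_Ann => //; apply: (lspanB Vv); exact: IV.
rewrite -(fill_id k u' xi); apply: (brace_absorb (r := lift k j0)).
- exact: Vfill.
- by rewrite fill_lift.
- by rewrite -vE'.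
- by rewrite -vE'.
Qed.

(** Along a path of arrows, an element of I stays in I up to the annihilator of
    the whole algebra; at an end point in V that error term vanishes. *)
Lemma class_absorb c : brace c -> I c -> class c `<=` I.
Proof.
move=> Dc Ic d cd; have Dd := class_brace Dc cd.
have /(classP _ (brace_sub Dc))[_ cd'] := cd.
have [x Ix dx] : exists2 x, I x & Ze (d - x).
  suff H u v : clos_refl_sym_trans A arrow u v ->
      (exists2 x, I x & Ze (u - x)) <-> (exists2 x, I x & Ze (v - x)).
    by apply/(H _ _ cd'); exists c => //; rewrite subrr; case: sZ.
  elim=> [a b|//|a b _ ->//|a b g _ -> _ ->//].
  exact: arrow_absorb.
have /subr0_eq -> // : d - x = 0.
apply: overbrace_Ann => //; apply: lspanB; [exact: brace_V|exact: IV].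
Qed.

(** Let w be a product of vectors of one of the two classes having a component
    in the other. A suitable product p of w with vectors of that other class is
    nonzero. It lies in I because one of its factors does: w itself when w is
    formed from the class of c, the other factors when w is formed from the
    class of d. Division puts all the factors of p in I, and so reaches the class
    of d, in the second case after a further division of w. *)
Lemma link_absorb c d : brace c -> brace d -> link f B c d ->
  class c `<=` I -> class d `<=` I.
Proof.
move=> Dc Dd cd cI.
have [Bc Bd] := (brace_sub Dc, brace_sub Dd).
have Vcl a : brace a -> forall x, class a x -> V x.
  by move=> Da x /(class_brace Da); exact: brace_V.
case: (link_produces Bc Bd cd) => -[t [tC nt]].
- have It : I (f t).
    apply: (ideal_entry (r := lift (Ordinal n1) j0) iI) => [j|].
      exact: (Vcl c).
    exact: cI.
  have [k [b [db fb]]] := component_partner Dd nt.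
  have Vb j : V (fill k (f t) b j).
    apply: (@fill_all _ _ _ (fun _ => V)); first exact: IV.
    by move=> i; exact: (Vcl d).
  have Ib : I (b j0).
    rewrite -(fill_lift k (f t) b j0); apply: (brace_absorb (r := lift k j0)) => //.
      by rewrite fill_lift; exact: (class_brace Dd).
    by apply: (ideal_entry (r := k) iI) => //; rewrite fill_id.
  rewrite (class_eq Bd (db j0)); apply: class_absorb => //.
  exact: (class_brace Dd).
- have [k [b [cb fb]]] := component_partner Dc nt.
  have Vt : V (f t) by apply: subalgebra_overbrace.2 => j; exact: (Vcl d).
  have Vb j : V (fill k (f t) b j).
    apply: (@fill_all _ _ _ (fun _ => V)) => // i; exact: (Vcl c).
  have It : I (f t).
    rewrite -(fill_id k (f t) b); apply: (brace_absorb (r := lift k j0)) => //.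
      by rewrite fill_lift; exact: (class_brace Dc).
    apply: (ideal_entry (r := lift k j0) iI) => //.
    by rewrite fill_lift; exact: cI.
  have ft : f t != 0 by apply: contra_notN nt => /eqP ->; exact: lspan0.
  have Itk : I (t k).
    apply: (brace_absorb (r := k)) => // [j|]; first exact: (Vcl d).
    exact: (class_brace Dd).
  rewrite (class_eq Bd (tC k)); apply: class_absorb => //.
  exact: (class_brace Dd).
Qed.

Lemma approx_absorb c : brace c -> (class c `<=` I <-> class e `<=` I).
Proof.
move=> [Bc [/Acl_inj ->//|[m [xi [Bxi x0 xm xl]]]]].
have Dxi r : (r <= m)%N -> brace (xi r).
  move=> rm; split; first exact: Bxi.
  right; exists r, xi; split=> // [s sr|s sr]; first by apply: Bxi; exact: leq_trans rm.
  by apply: xl; exact: leq_trans rm.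
rewrite -xm -x0 {x0 xm Bc}.
elim: m Bxi xl Dxi => [//|m IH] Bxi xl Dxi.
rewrite -IH => [|r rm|r rm|r rm]; last exact/Dxi/leqW.
- have [Dm DSm] := (Dxi m (leqnSn m), Dxi m.+1 (leqnn _)).
  have lm := xl m (ltnSn m).
  by split; [exact: (link_absorb DSm Dm (link_sym lm))|exact: link_absorb lm].
- exact/Bxi/leqW.
- by apply: xl; exact: leqW.
Qed.

Lemma ideal_full x : I x -> x != 0 -> I = V.
Proof.
move=> Ix x0; apply/seteqP; split; first exact: IV.
have Vx := IV Ix; have [k [b [Db fx]]] := nonzero_partner Vx x0.
have Ib : I (b j0).
  have Vb j : V (fill k x b j).
    by apply: (@fill_all _ _ _ (fun _ => V)) => // i; exact: brace_V.
  rewrite -(fill_lift k x b j0); apply: (brace_absorb (r := lift k j0)) => //.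
    by rewrite fill_lift.
  by apply: (ideal_entry (r := k) iI) => //; rewrite fill_id.
rewrite overbraceE; apply: lspan_min => // d Dd.
apply: (proj2 (approx_absorb Dd)); last by apply: class_self; exact: brace_sub.
by apply/(approx_absorb (Db j0)); exact: class_absorb.
Qed.

End Division.

Lemma division_simple : Ann f V = [set 0] -> i_division_basis f V (B `&` V) ->
  simple f V.
Proof.
move=> annV divV; have De := brace_self; split.
  have Ve : V e by rewrite overbraceE; exact: lspan_sub.
  have [k [b [Db fe]]] := nonzero_partner annV Ve (indep_neq0 iB Be).
  exists (fill k e b); split=> // j.
  apply: (@fill_all _ _ _ (fun _ => V)) => // i.
  by rewrite overbraceE; exact: lspan_sub.
move=> I iI; have [[x [Ix x0]]|H] := pselect (exists x, I x /\ x != 0).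
  by right; exact: (ideal_full annV divV iI Ix x0).
left; apply/seteqP; split=> [x Ix|_ ->]; last by case: iI => -[].
by apply: contrapT => /eqP x0; apply: H; exists x.
Qed.

End Overbrace.
End Connection.

Theorem theorem5p2 (F : fieldType) (n : nat) (hn : (2 <= n)%N)
    (A : lmodType F) (f : {ffun 'I_n -> A} -> A) (hf : multilinear f)
    (B : set A) (hB : is_basis setT B) (e : A) (he : B e) :
  simple f (overbrace f B e) <->
    Ann f (overbrace f B e) = [set 0] /\
    i_division_basis f (overbrace f B e) (B `&` overbrace f B e).
Proof.
split=> [|[]]; last exact: division_simple.
apply: simple_division => //; first exact: ltnW.
  exact: subalgebra_overbrace.
exact: overbrace_basis.
Qed.
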